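(* Let $K,T\subseteq\mathbb R^d$ be unconditional convex sets. Then \[ \gamma_d(K+T)\,\gamma_d(K\cap T)\;\ge\;\gamma_d(K)\,\gamma_d(T). \]
   Context: $\gamma_d$ denotes the standard Gaussian probability measure on $\mathbb R^d$, with density proportional to $e^{-\|x\|^2/2}$. $K+T=\{x+y: x\in K,\ y\in T\}$ is the Minkowski sum. A set is unconditional if it is symmetric with respect to every coordinate hyperplane, i.e. invariant under $(x_1,\dots,x_d)\mapsto(\pm x_1,\dots,\pm x_d)$ for every choice of signs. *)

(* Defs.v *)
From HB Require Import structures.
From mathcomp Require Import all_boot all_order all_algebra.
From mathcomp Require Import all_classical all_reals all_analysis.

Set Implicit Arguments.
Unset Strict Implicit.
Unset Printing Implicit Defensive.

Import Order.TTheory GRing.Theory Num.Theory.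
Local Open Scope classical_set_scope.
Local Open Scope ring_scope.

(* Standard Gaussian measure on d.-tuple R (product sigma-algebra), defined as
   the iterated integral against the 1-dimensional standard normal
   probability [normal_prob 0 1] (density e^{-x^2/2}/sqrt(2 pi)).
   For measurable B this is the d-fold product measure (Tonelli). *)
Fixpoint gauss_tuple (R : realType) (n : nat) : set (n.-tuple R) -> \bar R :=
  match n return set (n.-tuple R) -> \bar R with
  | 0 => fun A => (\1_A [tuple] : R)%:E
  | m.+1 => fun A =>
      (\int[@normal_prob R 0 1]_x
          @gauss_tuple R m [set t | A (cons_tuple x t)])%E
  end.

Definition rV_tuple (R : realType) (d : nat) (x : 'rV[R]_d) : d.-tuple R :=
  [tuple x ord0 i | i < d].

(* gamma_d on R^d = 'rV[R]_d: the (outer) standard Gaussian measure,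
   i.e. the inf of the Gaussian measure of Borel supersets.  On Lebesgue
   measurable sets (in particular convex sets) it coincides with the
   (completed) standard Gaussian measure. *)
Definition gamma (R : realType) (d : nat) (A : set 'rV[R]_d) : \bar R :=
  ereal_inf [set @gauss_tuple R d B | B in
    [set B : set (d.-tuple R) | measurable B /\ A `<=` @rV_tuple R d @^-1` B]].

Definition minkowski_sum (R : realType) (d : nat) (K T : set 'rV[R]_d)
  : set 'rV[R]_d :=
  [set z | exists x y, K x /\ T y /\ z = x + y].

Definition unconditional (R : realType) (d : nat) (K : set 'rV[R]_d) :=
  forall (s : 'I_d -> bool) (x : 'rV[R]_d),
    K x -> K (\row_i (if s i then - x ord0 i else x ord0 i)).

(* Main.v *)
(** An unconditional convex set is solid: with x it contains every y such that
    |y_i| <= |x_i| for all i.  If x is in K and y in T, both solid, then any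
    point whose coordinates are bounded by max(|x_i|, |y_i|) splits
    coordinatewise as a sum in K + T, and any point bounded by
    min(|x_i|, |y_i|) is in K and in T.  The inequality is
    therefore an instance of the four functions theorem for product measures,
    proved by induction on the dimension; in dimension one the functions are
    nonincreasing in |x|.  Such monotone section functions are automatically
    measurable, so the iterated integral makes sense for solid sets without
    assuming them Borel, and it agrees with the outer measure because a solid
    set has a Borel superset with the same iterated integral. *)
Require Import Defs.
From HB Require Import structures.
From mathcomp Require Import all_boot all_order all_algebra.
From mathcomp Require Import all_classical all_reals all_analysis.
From mathcomp Require Import measurable_realfun.
From mathcomp Require Import ring lra.
Import Order.TTheory GRing.Theory Num.Theory.
Local Open Scope classical_set_scope.
Local Open Scope ring_scope.

(* No measurability is assumed: slices of arbitrary sets, which occur in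
   [gauss_tuple], need not have measurable section measures. *)
Lemma le_integralT_ge0 d (T : measurableType d) (R : realType)
    (mu : {measure set T -> \bar R}) (f g : T -> \bar R) :
  (forall x, 0 <= f x)%E -> (forall x, f x <= g x)%E ->
  (\int[mu]_x f x <= \int[mu]_x g x)%E.
Proof.
move=> f0 fg.
rewrite !ge0_integralTE// => [|x]; last exact: le_trans (f0 x) (fg x).
by apply: ereal_sup_le => _ [h /= hf <-]; exists h => // x;
  exact: le_trans (fg x).
Qed.

(** For [P > 0], expanding [(P - p) * (P - q) >= 0] gives [P * (p + q) <= P * P + p * q], and the
    bound on [p * q] allows division by [P]. *)
Lemma ler_add_of_mul (R : realFieldType) (p q P Q : R) :
  0 <= p -> 0 <= q -> 0 <= Q -> p <= P -> q <= P -> p * q <= P * Q ->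
  p + q <= P + Q.
Proof.
move=> p0 q0 Q0 pP qP pq.
have [P0|P0] := leP P 0; first lra.
rewrite -(ler_pM2l P0); nra.
Qed.

(** * The four functions inequality on the line *)

Section radial.
Context {R : realType}.
Implicit Types a b c d f : R -> \bar R.
Local Notation N01 := (normal_prob (0 : R) 1).

Definition radial_profile f :=
  (forall x, 0 <= f x <= 1)%E /\
  (forall x y : R, `|x| <= `|y| -> (f y <= f x)%E).

Lemma radial_profile_fineK f : radial_profile f ->
  forall x, ((fine (f x))%:E = f x)%E.
Proof.
move=> [f01 _] x; rewrite fineK//; have /andP[f0 f1] := f01 x.
by rewrite ge0_fin_numE// (le_lt_trans f1)// ltry.
Qed.

Lemma measurable_radial_profile f : radial_profile f ->
  measurable_fun setT f.
Proof.
move=> rf; have fE := radial_profile_fineK _ rf.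
(* Truncating at 0 turns the profile on the half-line into a function that is nonincreasing on all
   of R. *)
have -> : f = EFin \o ((fun x => fine (f (Num.max x 0))) \o Num.norm).
  apply/funext => x /=; rewrite fE; apply/eqP; rewrite eq_le.
  by rewrite !(rf.2)// max_l// normr_id.
apply/measurable_EFinP/measurableT_comp; last exact: normr_measurable.
apply: nonincreasing_measurable => // x y xy; rewrite -lee_fin !fE.
have max0 z : 0 <= Num.max z 0 :> R by rewrite le_max lexx orbT.
by apply: rf.2; rewrite !ger0_norm// ge_max !le_max xy lexx orbT.
Qed.

Lemma integral_profile f : radial_profile f ->
  (0 <= \int[N01]_x f x <= 1)%E.
Proof.
move=> [f01 _]; rewrite integral_ge0 => [|x _]; last by case/andP: (f01 x).
apply: (@le_trans _ _ (\int[N01]_x (cst 1%E x)))%E.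
  by apply: le_integralT_ge0 => x; case/andP: (f01 x).
by rewrite integral_cst// mul1e; apply: probability_le1.
Qed.

Lemma four_functions_radial a b c d :
  radial_profile a -> radial_profile b ->
  radial_profile c -> radial_profile d ->
  (forall x y : R, `|y| <= `|x| ->
    (a x * b y <= c x * d y)%E /\ (a y * b x <= c x * d y)%E) ->
  (\int[N01]_x a x * \int[N01]_x b x <= \int[N01]_x c x * \int[N01]_x d x)%E.
Proof.
move=> ra rb rc rd abcd.
(* Symmetrizing in (x, y) brings in the maximum and the minimum of |x| and |y|
   at once; integrating in x and in y gives twice the conclusion. *)
have pt x y : (a x * b y + a y * b x <= c x * d y + c y * d x)%E.
  wlog xy : x y / `|y| <= `|x|.
    move=> H; have [/H//|/ltW/H] := leP `|y| `|x|.
    by rewrite addeC [leRHS]addeC.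
  have [+ +] := abcd x y xy; have [+ _] := abcd _ _ (lexx `|x|).
  have [+ _] := abcd _ _ (lexx `|y|).
  have := (ra.1 x, ra.1 y, rb.1 x, rb.1 y).
  have := (rc.1 x, rc.1 y, rd.1 x, rd.1 y).
  have E f (rf : radial_profile f) z := esym (radial_profile_fineK _ rf z).
  rewrite (E _ ra x) (E _ ra y) (E _ rb x) (E _ rb y).
  rewrite (E _ rc x) (E _ rc y) (E _ rd x) (E _ rd y).
  rewrite -!EFinM -!EFinD !lee_fin.
  move: (fine (a x)) (fine (a y)) (fine (b x)) (fine (b y)) => ax ay bx by_.
  move: (fine (c x)) (fine (c y)) (fine (d x)) (fine (d y)) => cx cy dx dy.
  move=> [[[/andP[cx0 _] /andP[cy0 _]] /andP[dx0 _]] /andP[dy0 _]].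
  move=> [[[/andP[ax0 _] /andP[ay0 _]] /andP[bx0 _]] /andP[by0 _]] hy hx h1 h2.
  apply: ler_add_of_mul => //; rewrite ?mulr_ge0//.
  (* Regrouped this way, the product bound follows from the diagonal cases of the hypothesis, at [x]
     and at [y]. *)
  rewrite (_ : _ * _ = ax * bx * (ay * by_)); last by ring.
  rewrite (_ : cx * dy * _ = cx * dx * (cy * dy)); last by ring.
  by rewrite ler_pM// mulr_ge0.
have inner f g y : radial_profile f -> radial_profile g ->
  (\int[N01]_x (f x * g y + f y * g x) =
   \int[N01]_x f x * g y + f y * \int[N01]_x g x)%E.
  move=> rf rg; have f0 z : (0 <= f z)%E by case/andP: (rf.1 z).
  have g0 z : (0 <= g z)%E by case/andP: (rg.1 z).
  have mf := measurable_radial_profile _ rf.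
  have mg := measurable_radial_profile _ rg.
  rewrite ge0_integralD//=; last 4 first.
  - by move=> x _; exact: mule_ge0.
  - exact: emeasurable_funM.
  - by move=> x _; exact: mule_ge0.
  - exact: emeasurable_funM.
  by rewrite ge0_integralZr// ge0_integralZl.
have outer f g : radial_profile f -> radial_profile g ->
  (\int[N01]_y (\int[N01]_x f x * g y + f y * \int[N01]_x g x) =
   \int[N01]_x f x * \int[N01]_x g x + \int[N01]_x f x * \int[N01]_x g x)%E.
  move=> rf rg; have f0 z : (0 <= f z)%E by case/andP: (rf.1 z).
  have g0 z : (0 <= g z)%E by case/andP: (rg.1 z).
  have mf := measurable_radial_profile _ rf.
  have mg := measurable_radial_profile _ rg.
  have /andP[If0 _] := integral_profile _ rf.
  have /andP[Ig0 _] := integral_profile _ rg.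
  rewrite ge0_integralD//=; last 4 first.
  - by move=> x _; exact: mule_ge0.
  - exact: emeasurable_funM.
  - by move=> x _; exact: mule_ge0.
  - exact: emeasurable_funM.
  by rewrite ge0_integralZl// ge0_integralZr.
have : (\int[N01]_y \int[N01]_x (a x * b y + a y * b x) <=
        \int[N01]_y \int[N01]_x (c x * d y + c y * d x))%E.
  have ab0 x y : (0 <= a x * b y + a y * b x)%E.
    have := (ra.1 x, ra.1 y, rb.1 x, rb.1 y).
    move=> [[[/andP[? _] /andP[? _]] /andP[? _]] /andP[? _]].
    by rewrite adde_ge0// mule_ge0.
  apply: le_integralT_ge0 => y; first exact: integral_ge0.
  exact: le_integralT_ge0.
under eq_integral do rewrite inner//.
under [leRHS]eq_integral do rewrite inner//.
rewrite !outer//.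
(* Finiteness of the four integrals allows the factor 2 on both sides to be cancelled. *)
have fin f : radial_profile f -> exists r, (\int[N01]_x f x = r%:E)%E.
  move=> /integral_profile /andP[f0 f1]; exists (fine (\int[N01]_x f x)%E).
  by rewrite fineK// ge0_fin_numE// (le_lt_trans f1)// ltry.
have [[p ->] [q ->]] := (fin _ ra, fin _ rb).
have [[r ->] [s ->]] := (fin _ rc, fin _ rd).
by rewrite -!EFinM -!EFinD !lee_fin; lra.
Qed.
End radial.

(** * Iterated Gaussian integrals of solid sets *)

Section gauss_solid.
Context {R : realType}.
Local Notation N01 := (normal_prob (0 : R) 1).

Lemma gauss_tuple_ge0_le1 n (A : set (n.-tuple R)) :
  (0 <= gauss_tuple A <= 1)%E.
Proof.
elim: n A => [|n IH] A /=; first by rewrite !lee_fin indicE ler0n lern1 leq_b1.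
rewrite integral_ge0 => [|x _];
  last by case/andP: (IH [set t | A (cons_tuple x t)]).
apply: (@le_trans _ _ (\int[N01]_x (cst 1%E x)))%E.
  apply: (@le_integralT_ge0 _ _ _ N01) => x;
    by case/andP: (IH [set t | A (cons_tuple x t)]).
by rewrite integral_cst// mul1e; apply: probability_le1.
Qed.

Lemma le_gauss_tuple n (A B : set (n.-tuple R)) : A `<=` B ->
  (gauss_tuple A <= gauss_tuple B)%E.
Proof.
elim: n A B => [|n IH] A B AB /=; first rewrite lee_fin !indicE ler_nat.
  by have [/set_mem/AB/mem_set->|] := boolP (_ \in A).
apply: (@le_integralT_ge0 _ _ _ N01) => x.
  by case/andP: (gauss_tuple_ge0_le1 _ [set t | A (cons_tuple x t)]).
by apply: IH => t; exact: AB.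
Qed.

Definition solid {n} (A : set (n.-tuple R)) :=
  forall s t, A t -> (forall i, `|tnth s i| <= `|tnth t i|) -> A s.

Definition slice {n} (A : set (n.+1.-tuple R)) (x : R) : set (n.-tuple R) :=
  [set t | A (cons_tuple x t)].

Lemma solid_slice n (A : set (n.+1.-tuple R)) x : solid A -> solid (slice A x).
Proof.
move=> sA s t At st; apply: sA At _ => i.
by case: (unliftP ord0 i) => [j|] ->; rewrite ?tnthS// !tnth0.
Qed.

Lemma slice_solidS n (A : set (n.+1.-tuple R)) (x y : R) : solid A ->
  `|x| <= `|y| -> slice A y `<=` slice A x.
Proof.
move=> sA xy t At; apply: sA At _ => i.
by case: (unliftP ord0 i) => [j|] ->; rewrite ?tnthS// !tnth0.
Qed.

Lemma radial_profile_slice n (A : set (n.+1.-tuple R)) : solid A ->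
  radial_profile (fun x => gauss_tuple (slice A x)).
Proof.
move=> sA; split=> [x|x y xy]; first exact: gauss_tuple_ge0_le1.
by apply: le_gauss_tuple; exact: slice_solidS.
Qed.

(** [C] and [D] stay free, rather than being a sum and an intersection, so that slices taken at
    different heads satisfy the hypotheses again. *)
Lemma gauss_tuple_four_functions n (A B C D : set (n.-tuple R)) :
  solid A -> solid B -> solid C -> solid D ->
  (forall s t u, A s -> B t ->
    (forall i, `|tnth u i| <= Num.max `|tnth s i| `|tnth t i|) -> C u) ->
  A `&` B `<=` D ->
  (gauss_tuple A * gauss_tuple B <= gauss_tuple C * gauss_tuple D)%E.
Proof.
elim: n A B C D => [|n IH] A B C D sA sB sC sD ABC ABD /=.
  rewrite -!EFinM lee_fin !indicE.
  have [/set_mem As|_] := boolP (_ \in A); last by rewrite mul0r mulr_ge0.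
  have [/set_mem Bs|_] := boolP (_ \in B); last by rewrite mulr0 mulr_ge0.
  by rewrite !mem_set//; [exact: ABD|apply: ABC As Bs _ => -[]].
apply: (@four_functions_radial _ (fun x => gauss_tuple (slice A x))
  (fun x => gauss_tuple (slice B x)) (fun x => gauss_tuple (slice C x))
  (fun x => gauss_tuple (slice D x))); try exact: radial_profile_slice.
(* [C] is sliced at the outer point [x], whose modulus is the maximum; [D] is sliced at the inner
   point [y], where slices of solid sets are larger. *)
move=> x y yx; split.
- apply: IH; try exact: solid_slice.
  + move=> s t u As Bt u_le; apply: ABC As Bt _ => i.
    by case: (unliftP ord0 i) => [j|] ->; rewrite ?tnthS// !tnth0 le_max lexx.
  + move=> t [At Bt]; apply: ABD; split=> //; exact: slice_solidS At.
- apply: IH; try exact: solid_slice.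
  + move=> s t u As Bt u_le; apply: ABC As Bt _ => i.
    by case: (unliftP ord0 i) => [j|] ->; rewrite ?tnthS//;
      rewrite !tnth0 le_max lexx orbT.
  + move=> t [At Bt]; apply: ABD; split=> //; exact: slice_solidS Bt.
Qed.

(** At each such point some rational separates the two values. A given rational can do so at only
    one modulus, hence at no more than two points. *)
Lemma countable_radial_jumps (f g : R -> \bar R) :
  radial_profile f -> radial_profile g ->
  (forall x y : R, `|x| < `|y| -> (g y <= f x)%E) ->
  countable [set x | (f x < g x)%E].
Proof.
move=> rf rg gf.
pose J (r : rat) : set R := [set x | (f x < (ratr r)%:E < g x)%E].
have -> : [set x | (f x < g x)%E] = \bigcup_r J r.
  apply/seteqP; split=> [x /= fg|x [r _ /andP[]]]; last exact: lt_trans.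
  have := fg; rewrite -(radial_profile_fineK _ rf) -(radial_profile_fineK _ rg).
  rewrite lte_fin => /rat_in_itvoo[r]; rewrite in_itv/= -!lte_fin.
  by rewrite !radial_profile_fineK// => h; exists r.
apply: bigcup_countable => // r _.
have [->|/set0P[x /andP[fx gx]]] := eqVneq (J r) set0; first exact: countable0.
apply: (@sub_countable _ _ _ [set x; - x]);
  last exact/finite_set_countable/finite_set2.
apply: subset_card_le => y /andP[fy gy].
have [/eqP|] := eqVneq `|y| `|x|.
  by rewrite eqr_norm2 => /orP[]/eqP ->; [left|right].
rewrite neq_lt => /orP[yx|xy].
- by have := le_lt_trans (gf _ _ yx) (lt_trans fy gx); rewrite ltxx.
- by have := le_lt_trans (gf _ _ xy) (lt_trans fx gy); rewrite ltxx.
Qed.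

Lemma normal_prob_countable (N : set R) : countable N -> N01.-negligible N.
Proof.
move=> cN; have mN : measurable N by apply: countable_measurable.
exists N; split => //.
have := @normal_prob_dominates R 0 1.
move=> /null_content_dominatesP; apply => //.
exact: countable_lebesgue_measure0.
Qed.

(* Sections of a solid set shrink as the first coordinate moves away from 0, so
   the sections at rational points already cover it; the section measure of
   this cover differs from the original one only at jumps of a monotone
   function. *)
Lemma solid_measurable_hull n (A : set (n.-tuple R)) : solid A ->
  exists B, [/\ measurable B, A `<=` B & (gauss_tuple B <= gauss_tuple A)%E].
Proof.
elim: n A => [|n IH] A sA.
  exists A; split=> //.
  have [A0|nA0] := pselect (A [tuple]).
    rewrite (_ : A = setT); first exact: measurableT.
    by apply/seteqP; split=> // t _; rewrite (tuple0 t).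
  rewrite (_ : A = set0); first exact: measurable0.
  by apply/seteqP; split=> // t; rewrite (tuple0 t).
have /choice[F hF] : forall q : rat, exists B : set (n.-tuple R),
    [/\ measurable B, slice A (ratr q) `<=` B &
    (gauss_tuple B <= gauss_tuple (slice A (ratr q)))%E].
  by move=> q; apply: IH; exact: solid_slice.
pose thead_lt (q : rat) : set (n.+1.-tuple R) :=
  [set s | `|thead s| < `|ratr q|].
pose behead_in (q : rat) : set (n.+1.-tuple R) :=
  (fun s : n.+1.-tuple R => [tuple of behead s] : n.-tuple R) @^-1` F q.
(* A tuple is in [B] when its tail lies in [F q] for every rational [q] of modulus at most that of
   its head. *)
pose B := \bigcap_q (thead_lt q `|` behead_in q).
exists B; split.
- rewrite -[B]setCK setC_bigcap; apply: measurableC.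
  apply: countable_bigcupT_measurable => // q.
  apply: measurableC; apply: measurableU.
  + rewrite (_ : thead_lt q =
        (fun s : n.+1.-tuple R => tnth s ord0) @^-1`
          `](- `|ratr q|), `|ratr q|[).
      rewrite -[X in measurable X]setTI.
      by apply: measurable_tnth => //; exact: measurable_itv.
    by apply/seteqP; split=> s; rewrite /thead_lt /thead/= in_itv/= ltr_norml.
  + rewrite -[X in measurable X]setTI.
    by apply: measurable_behead => //; case: (hF q).
- move=> s As q _; have [lt|le] := ltP `|thead s| `|ratr q|; first by left.
  right; have [_ + _] := hF q; apply.
  apply: (slice_solidS _ _ _ _ sA le) => /=.
  rewrite /slice/= [X in A X](_ : _ = s)// [s in RHS]tuple_eta.
  exact/val_inj.
pose f x := gauss_tuple (slice A x).
(* [g] is an upper bound for the slice measures of [B]; it remains to compare it with [f] almost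
   everywhere. *)
pose g (x : R) := ereal_inf [set f (ratr q) | q in
  [set q : rat | `|ratr q : R| <= `|x|]].
have rf : radial_profile f by exact: radial_profile_slice.
have gle (x : R) (q : rat) : `|ratr q : R| <= `|x| -> (g x <= f (ratr q))%E.
  by move=> qx; apply: ge_ereal_inf; exists (f (ratr q)) => //; exists q.
have rg : radial_profile g.
  split=> [x|x y xy].
    apply/andP; split.
      by apply/ereal_infP => _ [q _ <-]; case/andP: (rf.1 (ratr q)).
    (* The rational 0 is admissible for every [x], so the infimum never runs over an empty set. *)
    apply: (@le_trans _ _ (f (ratr 0))).
      by apply: gle; rewrite rmorph0 normr0.
    by case/andP: (rf.1 (ratr 0)).
  apply/ereal_infP => _ [q /= qx <-]; apply: gle.
  exact: le_trans xy.
apply: (@le_trans _ _ (\int[N01]_x g x)%E).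
  apply: (@le_integralT_ge0 _ _ _ N01) => x.
    by case/andP: (gauss_tuple_ge0_le1 _ [set t | B (cons_tuple x t)]).
  apply/ereal_infP => _ [q /= qx <-].
  have [_ _] := hF q; apply: le_trans; apply: le_gauss_tuple => t /(_ q I) [|].
    by rewrite /thead_lt/= theadE ltNge qx.
  rewrite /behead_in/=; congr (F q _); exact/val_inj.
apply: (@ae_ge0_le_integral _ _ _ N01) => //.
- by move=> x _; case/andP: (rg.1 x).
- exact: measurable_radial_profile.
- by move=> x _; case/andP: (rf.1 x).
- exact: measurable_radial_profile.
have : countable [set x | (f x < g x)%E].
  apply: countable_radial_jumps => // x y /rat_in_itvoo[q].
  rewrite in_itv/= => /andP[xq qy].
  have q0 : 0 <= ratr q :> R by rewrite (le_trans _ (ltW xq)).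
  apply: (le_trans (gle _ q _)); first by rewrite ger0_norm// ltW.
  by apply: rf.2; rewrite [leRHS]ger0_norm// ltW.
move=> /normal_prob_countable; apply: negligibleS => x /=.
by move=> /not_implyP[_ /negP]; rewrite -ltNge.
Qed.

End gauss_solid.

(** * Transfer to row vectors; solidity of convex sets and Minkowski sums *)

Section row_vectors.
Context {R : realType} {d : nat}.
Implicit Types (A : set (d.-tuple R)) (K T : set 'rV[R]_d) (x y z : 'rV[R]_d).

Definition tuple_rV (t : d.-tuple R) : 'rV[R]_d := \row_i tnth t i.

Lemma rV_tupleK : cancel (@rV_tuple R d) tuple_rV.
Proof. by move=> x; apply/rowP => i; rewrite mxE tnth_mktuple. Qed.

Lemma tuple_rVK : cancel tuple_rV (@rV_tuple R d).
Proof. by move=> t; apply: eq_from_tnth => i; rewrite tnth_mktuple mxE. Qed.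

(** The hull is one competitor in the infimum, and monotonicity of the iterated integral bounds
    every competitor from below. *)
Lemma gamma_solid A : solid A -> gamma (@rV_tuple R d @^-1` A) = gauss_tuple A.
Proof.
move=> sA; apply/eqP; rewrite eq_le; apply/andP; split.
  have [B [mB AB BA]] := solid_measurable_hull _ _ sA.
  apply: ge_ereal_inf; exists (gauss_tuple B) => //; exists B => //.
  by split=> // x; exact: AB.
apply/ereal_infP => _ [B [_ AB] <-]; apply: le_gauss_tuple => t At.
by rewrite -(tuple_rVK t); apply: AB; rewrite /= tuple_rVK.
Qed.

Definition solid_rV K :=
  forall x y, K x -> (forall i, `|y ord0 i| <= `|x ord0 i|) -> K y.

Lemma solid_tuple_rV K : solid_rV K -> solid (tuple_rV @^-1` K).
Proof. by move=> sK s t Kt st; apply: sK Kt _ => i; rewrite !mxE. Qed.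

Lemma gamma_solid_rV K : solid_rV K ->
  gamma K = gauss_tuple (tuple_rV @^-1` K).
Proof.
move=> sK; rewrite -gamma_solid; last exact: solid_tuple_rV.
by congr gamma; apply/seteqP; split=> x /=; rewrite rV_tupleK.
Qed.

Lemma convex_combination_rV K (t : R) x y :
  convex_set (K : set (convex_lmodType 'rV[R]_d)) -> 0 <= t -> t <= 1 ->
  K x -> K y -> K (t *: x + (1 - t) *: y).
Proof.
move=> cK t0 t1 Kx Ky.
by have /set_mem := cK x y (Itv01 t0 t1) (mem_set Kx) (mem_set Ky).
Qed.

(** Coordinates of [x] are replaced by those of [y] one at a time; each new point lies on the
    segment joining the previous one to its reflection in that coordinate. *)
Lemma unconditional_convex_solid K :
  convex_set (K : set (convex_lmodType 'rV[R]_d)) -> unconditional K ->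
  solid_rV K.
Proof.
move=> cK uK x y Kx yx.
pose z k : 'rV[R]_d := \row_(i < d) (if (i < k)%N then y ord0 i else x ord0 i).
suff Kz k : (k <= d)%N -> K (z k).
  have -> : y = z d by apply/rowP => i; rewrite mxE ltn_ord.
  exact: Kz.
elim: k => [|k IH] kd.
  by rewrite (_ : z 0%N = x)//; apply/rowP => i; rewrite mxE.
have {}IH := IH (ltnW kd); pose j := Ordinal kd.
have zE i : i != j -> z k.+1 ord0 i = z k ord0 i.
  by rewrite -val_eqE /= !mxE ltnS leq_eqVlt => /negbTE ->.
have zkj : z k ord0 j = x ord0 j by rewrite mxE /= ltnn.
have zSj : z k.+1 ord0 j = y ord0 j by rewrite mxE /= ltnSn.
have := yx j; have [xj0|xj0] := eqVneq (x ord0 j) 0.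
  rewrite xj0 normr0 normr_le0 => /eqP yj0.
  rewrite (_ : z k.+1 = z k)//; apply/rowP => i.
  by have [->|/zE//] := eqVneq i j; rewrite zkj zSj xj0.
move=> yxj; pose c := y ord0 j / x ord0 j.
have /andP[c1 c2] : -1 <= c <= 1.
  by rewrite -ler_norml normrM normfV ler_pdivrMr ?normr_gt0// mul1r.
(* The weight solves [t - (1 - t) = c], so coordinate [j] becomes [c * x_j = y_j]. *)
pose t := (1 + c) / 2.
rewrite (_ : z k.+1 = t *: z k +
    (1 - t) *: \row_i (if i == j then - z k ord0 i else z k ord0 i)).
  by apply: convex_combination_rV (uK _ _ IH) => //; rewrite /t; lra.
apply/rowP => i; have [->|ij] := eqVneq i j; last first.
  by rewrite zE// !mxE (negbTE ij); ring.
rewrite zSj mxE mxE zkj mxE mxE eqxx zkj /t /c; field.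
exact: xj0.
Qed.

Lemma solid_rV_minkowski_sum K T : solid_rV K -> solid_rV T ->
  solid_rV (minkowski_sum K T).
Proof.
move=> sK sT _ w [x [y [Kx [Ty ->]]]] wz.
(* Both summands are scaled by the same ratio. Where [x + y] vanishes, so does [w], and division by
   zero gives the ratio 0, still of modulus at most 1. *)
pose r i := w ord0 i / (x + y) ord0 i.
have r1 i : `|r i| <= 1.
  rewrite normrM normfV; have [xy0|xy0] := eqVneq ((x + y) ord0 i) 0.
    by rewrite xy0 normr0 invr0 mulr0.
  by rewrite ler_pdivrMr ?normr_gt0// mul1r.
exists (\row_i (r i * x ord0 i)), (\row_i (r i * y ord0 i)); split; last split.
- by apply: sK Kx _ => i; rewrite mxE normrM ler_piMl.
- by apply: sT Ty _ => i; rewrite mxE normrM ler_piMl.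
apply/rowP => i; rewrite !mxE -mulrDr /r.
have := wz i; rewrite !mxE; have [->|xy0 _] := eqVneq (x ord0 i + y ord0 i) 0.
  by rewrite normr0 normr_le0 mulr0 => /eqP.
by rewrite divfK.
Qed.

(** Each coordinate of [z] is assigned whole to the summand whose point has the larger modulus
    there, and the other summand gets 0. *)
Lemma minkowski_sum_max K T x y z : solid_rV K -> solid_rV T -> K x -> T y ->
  (forall i, `|z ord0 i| <= Num.max `|x ord0 i| `|y ord0 i|) ->
  minkowski_sum K T z.
Proof.
move=> sK sT Kx Ty zxy.
pose p i := `|y ord0 i| <= `|x ord0 i|.
exists (\row_i (if p i then z ord0 i else 0)),
  (\row_i (if p i then 0 else z ord0 i)).
split; last split.
- apply: sK Kx _ => i; rewrite mxE.
  case: ifPn => [pi|_]; last by rewrite normr0.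
  by rewrite (le_trans (zxy i))// ge_max lexx.
- apply: sT Ty _ => i; rewrite mxE; case: ifPn => [_|]; first by rewrite normr0.
  by rewrite -ltNge => /ltW pi; rewrite (le_trans (zxy i))// ge_max lexx andbT.
by apply/rowP => i; rewrite !mxE; case: ifP; rewrite ?addr0 ?add0r.
Qed.

End row_vectors.

Theorem theorem1p5 (R : realType) (d : nat) (K T : set 'rV[R]_d) :
  convex_set (K : set (convex_lmodType 'rV[R]_d)) ->
  convex_set (T : set (convex_lmodType 'rV[R]_d)) ->
  unconditional K -> unconditional T ->
  (gamma (minkowski_sum K T) * gamma (K `&` T) >= gamma K * gamma T)%E.
Proof.
move=> cK cT uK uT.
have sK := unconditional_convex_solid _ cK uK.
have sT := unconditional_convex_solid _ cT uT.
have sKT := solid_rV_minkowski_sum _ _ sK sT.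
have sI : solid_rV (K `&` T).
  by move=> x y [Kx Tx] yx; split; [exact: sK Kx yx|exact: sT Tx yx].
rewrite !gamma_solid_rV//.
apply: gauss_tuple_four_functions; try exact: solid_tuple_rV.
- move=> s t u Ks Tt u_le; apply: minkowski_sum_max sK sT Ks Tt _ => i.
  by rewrite !mxE.
- by move=> t [].
Qed.
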